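(* In each of the following pairs or triples, the categories mentioned are equivalent (in fact, isomorphic), and so are their full subcategories consisting of the objects whose underlying rack is medial: \begin{itemize} \item The category of racks and the category of Legendrian racks. \item The category of racks for which the canonical automorphism $\theta$ is an involution (kink-involutory racks) and the category of Legendrian quandles. \item The category of involutory GL-racks $(R,u)$ in which $u$ is an involution and the category of involutory symmetric racks. \item The category of involutory racks, the category of Legendrian kei, and the category of symmetric kei. \end{itemize}
   Context: An involution is a map $f$ with $f^2=\mathrm{id}$ (identity allowed). A rack is a pair $R=(X,s)$ where $X$ is a nonempty set and $s:X\to S_X$, $x\mapsto s_x$, is a map to the symmetric group of $X$ with $s_xs_y=s_{s_x(y)}s_x$ for all $x,y\in X$. It is a quandle if $s_x(x)=x$ for all $x$, involutory if $s_x^2=\mathrm{id}_X$ for all $x$, and a kei if it is an involutory quandle. A rack homomorphism $(X,s)\to(Y,t)$ is a map $\varphi$ with $\varphi s_x=t_{\varphi(x)}\varphi$ for all $x$; automorphisms are bijective homomorphisms from a rack to itself. The canonical automorphism $\theta$ of $R$ is $\theta(x)=s_x(x)$. A rack $R$ is medial if the map $X\times X\to X$, $(x,y)\mapsto s_y(x)$, is a rack homomorphism from the product rack $R\times R$ (componentwise structure) to $R$. A good involution of $(X,s)$ is an involution $\rho:X\to X$ such that $\rho s_x=s_x\rho$ and $s_{\rho(x)}=s_x^{-1}$ for all $x$. A symmetric rack (resp. symmetric kei) is a pair $(R,\rho)$ with $R$ a rack (resp. kei) and $\rho$ a good involution of $R$; morphisms $(R_1,\rho_1)\to(R_2,\rho_2)$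 are rack homomorphisms $\varphi$ with $\varphi\rho_1=\rho_2\varphi$. A symmetric rack $(R,\rho)$ is called involutory if $R$ is. A GL-structure on $R=(X,s)$ is a rack automorphism $u$ of $R$ with $us_x=s_xu$ for all $x$; the pair $(R,u)$ is a GL-rack, called involutory if $R$ is. Morphisms $(R_1,u_1)\to(R_2,u_2)$ of GL-racks are rack homomorphisms $\varphi$ with $\varphi u_1=u_2\varphi$. A Legendrian rack is a GL-rack $(R,u)$ with $\theta=u^{-2}$. A Legendrian quandle (resp. Legendrian kei) is a Legendrian rack $(R,u)$ with $R$ a quandle (resp. kei). Kink-involutory racks and involutory racks form full subcategories of the category of racks; Legendrian racks, Legendrian quandles, Legendrian kei, and involutory GL-racks with $u$ an involution form full subcategories of the category of GL-racks; symmetric kei and involutory symmetric racks form full subcategories of the category of symmetric racks. *)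

(* Defs.v *)
From mathcomp Require Import all_boot boolp.

Set Implicit Arguments.
Unset Strict Implicit.
Unset Printing Implicit Defensive.

Record category := Category {
  obj :> Type;
  hom : obj -> obj -> Type;
  idm : forall A, hom A A;
  compm : forall A B C, hom B C -> hom A B -> hom A C;
  compm_idl : forall A B (f : hom A B), compm (idm B) f = f;
  compm_idr : forall A B (f : hom A B), compm f (idm A) = f;
  compmA : forall A B C D (h : hom C D) (g : hom B C) (f : hom A B),
    compm h (compm g f) = compm (compm h g) f }.

Arguments hom {c} _ _.
Arguments idm {c} A.
Arguments compm {c A B C} _ _.

Record functor (C D : category) := Functor {
  fobj :> C -> D;
  fmap : forall A B : C, hom A B -> hom (fobj A) (fobj B);
  fmap_id : forall A : C, fmap (idm A) = idm (fobj A);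
  fmap_comp : forall (A B E : C) (g : hom B E) (f : hom A B),
    fmap (compm g f) = compm (fmap g) (fmap f) }.

Arguments fmap {C D} _ {A B} _.

Definition id_functor (C : category) : functor C C :=
  @Functor C C (fun A => A) (fun A B f => f)
    (fun A => erefl) (fun A B E g f => erefl).

Lemma comp_fmap_id (C D E : category) (G : functor D E) (F : functor C D)
  (A : C) : fmap G (fmap F (idm A)) = idm (G (F A)).
Proof. by rewrite !fmap_id. Qed.

Lemma comp_fmap_comp (C D E : category) (G : functor D E) (F : functor C D)
    (A B H : C) (g : hom B H) (f : hom A B) :
  fmap G (fmap F (compm g f)) = compm (fmap G (fmap F g)) (fmap G (fmap F f)).
Proof. by rewrite !fmap_comp. Qed.

Definition comp_functor (C D E : category) (G : functor D E) (F : functor C D)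
    : functor C E :=
  @Functor C E (fun A => G (F A)) (fun A B f => fmap G (fmap F f))
    (comp_fmap_id G F) (comp_fmap_comp G F).

Definition isomorphism (C : category) (A B : C) (f : hom A B) : Prop :=
  exists g : hom B A, compm g f = idm A /\ compm f g = idm B.

Definition naturally_isomorphic (C D : category) (F G : functor C D) : Prop :=
  exists eta : forall A : C, hom (F A) (G A),
    (forall (A B : C) (f : hom A B),
       compm (eta B) (fmap F f) = compm (fmap G f) (eta A)) /\
    (forall A : C, isomorphism (eta A)).

Definition equivalent_cat (C D : category) : Prop :=
  exists (F : functor C D) (G : functor D C),
    naturally_isomorphic (comp_functor G F) (id_functor C) /\
    naturally_isomorphic (comp_functor F G) (id_functor D).

Definition isomorphic_cat (C D : category) : Prop :=
  exists (F : functor C D) (G : functor D C),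
    comp_functor G F = id_functor C /\ comp_functor F G = id_functor D.

Definition equivalent_and_isomorphic (C D : category) : Prop :=
  equivalent_cat C D /\ isomorphic_cat C D.

Definition full_subcategory (C : category) (P : C -> Prop) : category :=
  @Category {A : C | P A} (fun A B => hom (sval A) (sval B))
    (fun A => idm (sval A)) (fun A B E g f => compm g f)
    (fun A B f => compm_idl f) (fun A B f => compm_idr f)
    (fun A B E H h g f => compmA h g f).

Definition inverse_of (X : Type) (f g : X -> X) : Prop :=
  cancel f g /\ cancel g f.

Record rack := Rack {
  carrier :> Type;
  sym : carrier -> carrier -> carrier;
  rack_nonempty : inhabited carrier;
  sym_bij : forall x, bijective (sym x);
  sym_sym : forall x y, sym x \o sym y =1 sym (sym x y) \o sym x }.

Arguments sym {r} _ _.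

Definition rack_hom_prop (R S : rack) (phi : R -> S) : Prop :=
  forall x, phi \o sym x =1 sym (phi x) \o phi.

Definition rack_automorphism (R : rack) (phi : R -> R) : Prop :=
  bijective phi /\ rack_hom_prop phi.

Definition theta (R : rack) (x : R) : R := sym x x.

Definition quandle (R : rack) : Prop := forall x : R, sym x x = x.

Definition involutory (R : rack) : Prop := forall x : R, involutive (sym x).

Definition kei (R : rack) : Prop := quandle R /\ involutory R.

Definition kink_involutory (R : rack) : Prop := involutive (@theta R).

Definition prod_sym (R S : rack) (p q : R * S) : R * S :=
  (sym p.1 q.1, sym p.2 q.2).

Lemma prod_nonempty (R S : rack) : inhabited (R * S).
Proof.
by case: (rack_nonempty R) (rack_nonempty S) => x [y]; exact: inhabits (x, y).
Qed.

Lemma prod_sym_bij (R S : rack) (p : R * S) : bijective (prod_sym p).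
Proof.
case: (sym_bij p.1) (sym_bij p.2) => f fK Kf [g gK Kg].
exists (fun q => (f q.1, g q.2)) => -[x y]; rewrite /prod_sym /=.
  by rewrite fK gK.
by rewrite Kf Kg.
Qed.

Lemma prod_sym_sym (R S : rack) (p q : R * S) :
  prod_sym p \o prod_sym q =1 prod_sym (prod_sym p q) \o prod_sym p.
Proof.
move=> z; rewrite /prod_sym /=.
have /= -> := sym_sym p.1 q.1 z.1.
by have /= -> := sym_sym p.2 q.2 z.2.
Qed.

Definition prod_rack (R S : rack) : rack :=
  Rack (prod_nonempty R S) (@prod_sym_bij R S) (@prod_sym_sym R S).

Definition medial (R : rack) : Prop :=
  @rack_hom_prop (prod_rack R R) R (fun p => sym p.2 p.1).

Definition GL_structure (R : rack) (u : R -> R) : Prop :=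
  rack_automorphism u /\ forall x, u \o sym x =1 sym x \o u.

Record GL_rack := GLRack {
  gl_rack :> rack;
  gl_map : gl_rack -> gl_rack;
  gl_mapP : GL_structure gl_map }.

Arguments gl_map {g} _.

Definition legendrian (L : GL_rack) : Prop :=
  inverse_of (@gl_map L \o @gl_map L) (@theta L).

Definition good_involution (R : rack) (rho : R -> R) : Prop :=
  [/\ involutive rho, forall x, rho \o sym x =1 sym x \o rho
    & forall x, inverse_of (sym x) (sym (rho x))].

Record symmetric_rack := SymmetricRack {
  sr_rack :> rack;
  sr_map : sr_rack -> sr_rack;
  sr_mapP : good_involution sr_map }.

Arguments sr_map {s} _.

Lemma rack_hom_id (R : rack) : @rack_hom_prop R R id.
Proof. by []. Qed.

Lemma rack_hom_comp (R S T : rack) (g : S -> T) (f : R -> S) :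
  rack_hom_prop g -> rack_hom_prop f -> rack_hom_prop (g \o f).
Proof.
by move=> gP fP x y /=; have /= -> := fP x y; have /= -> := gP (f x) (f y).
Qed.

Record rack_hom (R S : rack) := RackHom {
  rh_fun :> R -> S;
  rh_funP : rack_hom_prop rh_fun }.

Lemma rack_hom_ext (R S : rack) (f g : rack_hom R S) : f =1 g -> f = g.
Proof.
case: f g => [f fP] [g gP] /= /funext fg; case: g / fg in gP *.
by rewrite (Prop_irrelevance fP gP).
Qed.

Definition rack_hom_idm (R : rack) : rack_hom R R := RackHom (@rack_hom_id R).

Definition rack_hom_compm (R S T : rack) (g : rack_hom S T) (f : rack_hom R S)
    : rack_hom R T :=
  RackHom (rack_hom_comp (rh_funP g) (rh_funP f)).

Lemma rack_hom_idl (R S : rack) (f : rack_hom R S) :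
  rack_hom_compm (rack_hom_idm S) f = f.
Proof. exact: rack_hom_ext. Qed.

Lemma rack_hom_idr (R S : rack) (f : rack_hom R S) :
  rack_hom_compm f (rack_hom_idm R) = f.
Proof. exact: rack_hom_ext. Qed.

Lemma rack_hom_compA (R S T U : rack)
    (h : rack_hom T U) (g : rack_hom S T) (f : rack_hom R S) :
  rack_hom_compm h (rack_hom_compm g f) = rack_hom_compm (rack_hom_compm h g) f.
Proof. exact: rack_hom_ext. Qed.

Definition rack_cat : category :=
  Category rack_hom_idl rack_hom_idr rack_hom_compA.

Record GL_hom (A B : GL_rack) := GLHom {
  GL_hom_fun :> rack_hom A B;
  GL_hom_comm : GL_hom_fun \o @gl_map A =1 @gl_map B \o GL_hom_fun }.

Lemma GL_hom_ext (A B : GL_rack) (f g : GL_hom A B) : f =1 g -> f = g.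
Proof.
case: f g => [f fP] [g gP] /= /rack_hom_ext fg; case: g / fg in gP *.
by rewrite (Prop_irrelevance fP gP).
Qed.

Lemma GL_hom_idP (A : GL_rack) :
  rack_hom_idm A \o @gl_map A =1 @gl_map A \o rack_hom_idm A.
Proof. by []. Qed.

Definition GL_hom_idm (A : GL_rack) : GL_hom A A := GLHom (@GL_hom_idP A).

Lemma GL_hom_compP (A B C : GL_rack) (g : GL_hom B C) (f : GL_hom A B) :
  rack_hom_compm g f \o @gl_map A =1 @gl_map C \o rack_hom_compm g f.
Proof.
move=> x /=; have /= -> := GL_hom_comm f x.
by have /= -> := GL_hom_comm g (f x).
Qed.

Definition GL_hom_compm (A B C : GL_rack) (g : GL_hom B C) (f : GL_hom A B)
    : GL_hom A C :=
  GLHom (GL_hom_compP g f).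

Lemma GL_hom_idl (A B : GL_rack) (f : GL_hom A B) :
  GL_hom_compm (GL_hom_idm B) f = f.
Proof. exact: GL_hom_ext. Qed.

Lemma GL_hom_idr (A B : GL_rack) (f : GL_hom A B) :
  GL_hom_compm f (GL_hom_idm A) = f.
Proof. exact: GL_hom_ext. Qed.

Lemma GL_hom_compA (A B C D : GL_rack)
    (h : GL_hom C D) (g : GL_hom B C) (f : GL_hom A B) :
  GL_hom_compm h (GL_hom_compm g f) = GL_hom_compm (GL_hom_compm h g) f.
Proof. exact: GL_hom_ext. Qed.

Definition GL_cat : category :=
  Category GL_hom_idl GL_hom_idr GL_hom_compA.

Record sr_hom (A B : symmetric_rack) := SRHom {
  sr_hom_fun :> rack_hom A B;
  sr_hom_comm : sr_hom_fun \o @sr_map A =1 @sr_map B \o sr_hom_fun }.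

Lemma sr_hom_ext (A B : symmetric_rack) (f g : sr_hom A B) : f =1 g -> f = g.
Proof.
case: f g => [f fP] [g gP] /= /rack_hom_ext fg; case: g / fg in gP *.
by rewrite (Prop_irrelevance fP gP).
Qed.

Lemma sr_hom_idP (A : symmetric_rack) :
  rack_hom_idm A \o @sr_map A =1 @sr_map A \o rack_hom_idm A.
Proof. by []. Qed.

Definition sr_hom_idm (A : symmetric_rack) : sr_hom A A := SRHom (@sr_hom_idP A).

Lemma sr_hom_compP (A B C : symmetric_rack) (g : sr_hom B C) (f : sr_hom A B) :
  rack_hom_compm g f \o @sr_map A =1 @sr_map C \o rack_hom_compm g f.
Proof.
move=> x /=; have /= -> := sr_hom_comm f x.
by have /= -> := sr_hom_comm g (f x).
Qed.

Definition sr_hom_compm (A B C : symmetric_rack) (g : sr_hom B C) (f : sr_hom A B)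
    : sr_hom A C :=
  SRHom (sr_hom_compP g f).

Lemma sr_hom_idl (A B : symmetric_rack) (f : sr_hom A B) :
  sr_hom_compm (sr_hom_idm B) f = f.
Proof. exact: sr_hom_ext. Qed.

Lemma sr_hom_idr (A B : symmetric_rack) (f : sr_hom A B) :
  sr_hom_compm f (sr_hom_idm A) = f.
Proof. exact: sr_hom_ext. Qed.

Lemma sr_hom_compA (A B C D : symmetric_rack)
    (h : sr_hom C D) (g : sr_hom B C) (f : sr_hom A B) :
  sr_hom_compm h (sr_hom_compm g f) = sr_hom_compm (sr_hom_compm h g) f.
Proof. exact: sr_hom_ext. Qed.

Definition sr_cat : category :=
  Category sr_hom_idl sr_hom_idr sr_hom_compA.

(* A category together with the underlying rack of each object; it serves to
   select the full subcategory of medial objects, and functors between such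
   categories need not preserve underlying racks. *)
Record rack_based := RackBased {
  rb_cat :> category;
  underlying : rb_cat -> rack }.

Definition full_rack_based (C : rack_based) (P : C -> Prop) : rack_based :=
  @RackBased (full_subcategory P) (fun A => underlying (sval A)).

Definition medial_objects (C : rack_based) : rack_based :=
  full_rack_based (fun A : C => medial (underlying A)).

Definition racks : rack_based := @RackBased rack_cat id.
Definition GL_racks : rack_based := @RackBased GL_cat gl_rack.
Definition symmetric_racks : rack_based := @RackBased sr_cat sr_rack.

Definition kink_involutory_racks : rack_based :=
  @full_rack_based racks kink_involutory.

Definition involutory_racks : rack_based :=
  @full_rack_based racks involutory.

Definition legendrian_racks : rack_based :=
  @full_rack_based GL_racks legendrian.

Definition legendrian_quandles : rack_based :=
  @full_rack_based GL_racks (fun L : GL_rack => legendrian L /\ quandle L).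

Definition legendrian_kei : rack_based :=
  @full_rack_based GL_racks (fun L : GL_rack => legendrian L /\ kei L).

Definition involutory_GL_racks_with_involution : rack_based :=
  @full_rack_based GL_racks
    (fun L : GL_rack => involutory L /\ involutive (@gl_map L)).

Definition involutory_symmetric_racks : rack_based :=
  @full_rack_based symmetric_racks (fun S : symmetric_rack => involutory S).

Definition symmetric_kei : rack_based :=
  @full_rack_based symmetric_racks (fun S : symmetric_rack => kei S).

(* Main.v *)
From mathcomp Require Import all_boot boolp.
Require Import Defs.

Set Implicit Arguments.
Unset Strict Implicit.
Unset Printing Implicit Defensive.

(** A rack (X, t) corresponds to the Legendrian rack (X, s, u) with
    s_x = t_x theta_t and u = theta_t^-1; conversely t_x = s_x u, because then
    theta_t = theta_s u = u^-1.  Since t_(u x) = t_x, both constructions preserve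
    mediality.  As theta_s = theta_t^2, the Legendrian rack is a quandle if and
    only if t is kink-involutory, and it is a kei if and only if t is involutory.
    When s is involutory, an involution u commuting with every s_x is a rack
    automorphism if and only if s_(u x) = s_x = s_x^-1, that is, if and only if
    it is a good involution. *)

(** * Equality of functors *)

Definition cast_hom (C : category) (A A' B B' : C) (p : A = A') (q : B = B')
    (f : hom A B) : hom A' B' :=
  ecast B' (hom A' B') q (ecast A' (hom A' B) p f).

Lemma functor_ext (C D : category) (F G : functor C D)
    (e : forall A, F A = G A) :
  (forall A B (f : hom A B), cast_hom (e A) (e B) (fmap F f) = fmap G f) ->
  F = G.
Proof.
case: F G e => [F Ff Fi Fc] [G Gf Gi Gc] /= e; have FG := funext e.
case: G / FG in Gf Gi Gc e * => eF.
(* Equality lives in [Prop], so even a loop on an object is [erefl] and the casts disappear. *)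
have ee A : e A = erefl by exact: Prop_irrelevance.
have fFG : Ff = Gf.
  do 3![apply: functional_extensionality_dep => ?].
  by rewrite -eF !ee.
case: Gf / fFG in Gi Gc eF *.
by rewrite (Prop_irrelevance Fi Gi) (Prop_irrelevance Fc Gc).
Qed.

Definition faithful (C D : category) (J : functor C D) : Prop :=
  forall (A B : C) (f g : hom A B), fmap J f = fmap J g -> f = g.

(* Casts of homs along equalities of objects need not compute, whereas their
   images under a forgetful functor [J] do when [eJ] is reflexivity. *)
Lemma functor_ext_over (C D E : category) (J : functor D E)
    (F G : functor C D) (eJ : forall A, J (F A) = J (G A)) :
  faithful J -> (forall A, F A = G A) ->
  (forall A B (f : hom A B),
     cast_hom (eJ A) (eJ B) (fmap J (fmap F f)) = fmap J (fmap G f)) ->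
  F = G.
Proof.
move=> Jinj e FG; apply: (@functor_ext _ _ _ _ e) => A B f; apply: Jinj.
(* Destructing [e] turns both instances of [eJ] into loops, which are again [erefl]. *)
rewrite -FG; case: (G A) / (e A) (eJ A) => p; case: (G B) / (e B) (eJ B) => q.
by rewrite (Prop_irrelevance p erefl) (Prop_irrelevance q erefl).
Qed.

(** * Restriction of functors to full subcategories *)

Section Restriction.

Variables (C D : category) (P : C -> Prop) (Q : D -> Prop) (F : functor C D).
Hypothesis FPQ : forall A, P A -> Q (F A).

Definition restrict : functor (full_subcategory P) (full_subcategory Q) :=
  @Functor (full_subcategory P) (full_subcategory Q)
    (fun A => exist Q (F (sval A)) (FPQ (svalP A)))
    (fun A B f => fmap F f)
    (fun A => fmap_id F (sval A)) (fun A B E g f => fmap_comp F g f).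

End Restriction.

Definition inclusion (C : category) (P : C -> Prop) :
    functor (full_subcategory P) C :=
  @Functor (full_subcategory P) C (fun A => sval A) (fun A B f => f)
    (fun A => erefl) (fun A B E g f => erefl).

Lemma full_subcategory_eq (C : category) (P : C -> Prop)
    (A B : full_subcategory P) : sval A = sval B -> A = B.
Proof. by apply: eq_sig_hprop => ?; exact: Prop_irrelevance. Qed.

(** Objects on the two sides differ only in their membership proofs, which the inclusion forgets. *)
Lemma restrict_id (C : category) (P : C -> Prop) (H : functor C C)
    (HP : forall A, P A -> P (H A)) :
  H = id_functor C -> restrict HP = id_functor (full_subcategory P).
Proof.
move=> HE; rewrite {H}HE in HP *.
apply: (@functor_ext_over _ _ _ (inclusion P) (restrict HP) (id_functor _)
          (fun=> erefl)) => // A.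
exact: full_subcategory_eq.
Qed.

Lemma comp_functorA (A B C D : category) (H : functor C D) (G : functor B C)
    (F : functor A B) :
  comp_functor H (comp_functor G F) = comp_functor (comp_functor H G) F.
Proof.
exact: (@functor_ext _ _ (comp_functor H (comp_functor G F))
         (comp_functor (comp_functor H G) F) (fun=> erefl)).
Qed.

Lemma comp_id_functor (C D : category) (F : functor C D) :
  comp_functor (id_functor D) F = F.
Proof.
exact: (@functor_ext _ _ (comp_functor (id_functor D) F) F (fun=> erefl)).
Qed.

Lemma comp_restrict (C D : category) (P : C -> Prop) (Q : D -> Prop)
    (F : functor C D) (G : functor D C)
    (FP : forall A, P A -> Q (F A)) (GQ : forall B, Q B -> P (G B)) :
  comp_functor (restrict GQ) (restrict FP) =
  @restrict _ _ P P (comp_functor G F) (fun A PA => GQ _ (FP _ PA)).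
Proof.
apply: (@functor_ext_over _ _ _ (inclusion P)
          (comp_functor (restrict GQ) (restrict FP))
          (@restrict _ _ P P (comp_functor G F) (fun A PA => GQ _ (FP _ PA)))
          (fun=> erefl)) => // A.
exact: full_subcategory_eq.
Qed.

(** * Inverse functors and mediality *)

Definition inverse_functors (C D : category) (F : functor C D)
    (G : functor D C) : Prop :=
  comp_functor G F = id_functor C /\ comp_functor F G = id_functor D.

Lemma naturally_isomorphic_refl (C D : category) (F : functor C D) :
  naturally_isomorphic F F.
Proof.
exists (fun A => idm (F A)); split=> [A B f|A].
  by rewrite compm_idl compm_idr.
by exists (idm (F A)); rewrite !compm_idl.
Qed.

Lemma inverse_functors_equivalent (C D : category) (F : functor C D)
    (G : functor D C) :
  inverse_functors F G -> equivalent_and_isomorphic C D.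
Proof.
move=> [GF FG]; split; exists F, G; last by [].
by rewrite GF FG; split; exact: naturally_isomorphic_refl.
Qed.

(** The equivalence lets [G] restrict as well: [B] equals [F (G B)], so [Q B] yields [P (G B)]. *)
Lemma inverse_functors_restrict (C D : category) (F : functor C D)
    (G : functor D C) (P : C -> Prop) (Q : D -> Prop) :
  inverse_functors F G -> (forall A, P A <-> Q (F A)) ->
  exists (FP : forall A, P A -> Q (F A)) (GQ : forall B, Q B -> P (G B)),
    inverse_functors (restrict FP) (restrict GQ).
Proof.
move=> [GF FG] PQ.
have FP A : P A -> Q (F A) by move/PQ.
have GQ B : Q B -> P (G B).
  by move=> QB; apply/PQ; rewrite -[F (G B)]/(comp_functor F G B) FG.
by exists FP, GQ; split; rewrite comp_restrict; exact: restrict_id.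
Qed.

(** One relation that yields the claims for all objects and for the medial ones together, and that
    can be inverted and chained. *)
Definition medially_isomorphic (C D : rack_based) : Prop :=
  exists (F : functor C D) (G : functor D C), inverse_functors F G /\
    forall A : C, medial (underlying A) <-> medial (underlying (F A)).

Lemma medially_isomorphicP (C D : rack_based) : medially_isomorphic C D ->
  equivalent_and_isomorphic C D /\
  equivalent_and_isomorphic (medial_objects C) (medial_objects D).
Proof.
move=> [F [G [FG m]]]; split; first exact: inverse_functors_equivalent FG.
have [FP [GQ]] := @inverse_functors_restrict _ _ _ _
  (fun A : C => medial (underlying A)) (fun B : D => medial (underlying B)) FG m.
exact: inverse_functors_equivalent.
Qed.

Lemma medially_isomorphic_sym (C D : rack_based) :
  medially_isomorphic C D -> medially_isomorphic D C.
Proof.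
move=> [F [G [[GF FG] m]]]; exists G, F; split=> // B.
by rewrite m -[F (G B)]/(comp_functor F G B) FG.
Qed.

Lemma medially_isomorphic_trans (C D E : rack_based) :
  medially_isomorphic C D -> medially_isomorphic D E ->
  medially_isomorphic C E.
Proof.
move=> [F [G [[GF FG] mF]]] [F' [G' [[GF' FG'] mF']]].
exists (comp_functor F' F), (comp_functor G G'); split; last first.
  by move=> A; rewrite mF mF'.
split.
  by rewrite comp_functorA -(comp_functorA G) GF' -comp_functorA comp_id_functor.
by rewrite comp_functorA -(comp_functorA F') FG -comp_functorA comp_id_functor.
Qed.

(** Serves to cut smaller isomorphisms out of [legendrian_inverse] and [symmetric_inverse]. *)
Lemma medially_isomorphic_full (C D : rack_based) (F : functor C D)
    (G : functor D C) (P : C -> Prop) (Q : D -> Prop) :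
  inverse_functors F G ->
  (forall A : C, medial (underlying A) <-> medial (underlying (F A))) ->
  (forall A, P A <-> Q (F A)) ->
  medially_isomorphic (full_rack_based P) (full_rack_based Q).
Proof.
move=> FG m PQ; have [FP [GQ FGP]] := inverse_functors_restrict FG PQ.
by exists (restrict FP), (restrict GQ); split=> // A; exact: m.
Qed.

(** * Nested full subcategories *)

Section FullFull.

Variables (C : rack_based) (P R : C -> Prop) (Q : full_rack_based P -> Prop).
Hypothesis RP : forall A, R A -> P A.
Hypothesis QR : forall A : full_rack_based P, Q A <-> R (sval A).

Definition full_full_flatten :
    functor (full_rack_based Q) (full_rack_based R) :=
  @Functor (full_rack_based Q) (full_rack_based R)
    (fun A => exist R (sval (sval A)) (iffLR (QR (sval A)) (svalP A)))
    (fun A B f => f) (fun A => erefl) (fun A B E g f => erefl).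

Definition full_full_nest :
    functor (full_rack_based R) (full_rack_based Q) :=
  @Functor (full_rack_based R) (full_rack_based Q)
    (fun A => let A' := exist P (sval A) (RP (svalP A)) in
       exist Q A' (iffRL (QR A') (svalP A)))
    (fun A B f => f) (fun A => erefl) (fun A B E g f => erefl).

(** Objects of a nested full subcategory carry two membership proofs, so it is isomorphic, but not
    convertible, to the subcategory cut out in one go. *)
Lemma full_full_isomorphic :
  medially_isomorphic (full_rack_based Q) (full_rack_based R).
Proof.
exists full_full_flatten, full_full_nest; split; last by [].
split.
  apply: (@functor_ext_over _ _ _ (comp_functor (inclusion P) (inclusion Q))
            (comp_functor full_full_nest full_full_flatten) (id_functor _)
            (fun=> erefl)) => // A.
  by do 2!apply: full_subcategory_eq.
apply: (@functor_ext_over _ _ _ (inclusion R)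
          (comp_functor full_full_flatten full_full_nest) (id_functor _)
          (fun=> erefl)) => // A.
exact: full_subcategory_eq.
Qed.

End FullFull.

(** * Equality of racks and GL-racks on a common carrier *)

Lemma rack_eq (R : rack) (t : R -> R -> R) n b ss :
  t =2 @sym R -> @Rack R t n b ss = R.
Proof.
case: R t n b ss => [X s n' b' ss'] /= t n b ss ts.
have {}ts : t = s by do 2![apply: funext => ?].
case: s / ts in b' ss' *.
congr (Rack _ _ _); exact: Prop_irrelevance.
Qed.

Lemma GL_rack_eq (L : GL_rack) (t : L -> L -> L) n b ss (u : L -> L) uP :
  t =2 @sym L -> u =1 @gl_map L -> @GLRack (@Rack L t n b ss) u uP = L.
Proof.
case: L t n b ss u uP => [[X s n' b' ss'] v vP] /= t n b ss u uP ts /funext uv.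
have {}ts : t = s by do 2![apply: funext => ?].
case: s / ts in b' ss' v vP uv *.
(* The type of [uP] mentions the rack laws, so their proofs are identified before the GL-maps. *)
rewrite (Prop_irrelevance n n') (Prop_irrelevance b b') in uP *.
rewrite (Prop_irrelevance ss ss') in uP *.
case: v / uv in vP *; congr GLRack; exact: Prop_irrelevance.
Qed.

(** * The canonical automorphism *)

Section Theta.

Variable R : rack.
Implicit Types x y : R.

Lemma rack_sd x y z : sym x (sym y z) = sym (sym x y) (sym x z).
Proof. exact: sym_sym. Qed.

Lemma theta_sym x y : theta (sym x y) = sym x (theta y).
Proof. by rewrite /theta -rack_sd. Qed.

(** The rack law at x, x reads s_x s_x = s_(theta x) s_x, and the surjective s_x cancels on the
    right. *)
Lemma sym_theta x y : sym (theta x) y = sym x y.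
Proof.
have [g _ Kg] := sym_bij x.
by rewrite -(Kg y) -/(theta _) /theta -rack_sd.
Qed.

(** The inverse sends x to s_x^-1(x). If s_x(y) = x, then s_x(theta y) = theta(s_x(y)) = theta x =
    s_x(x), hence theta y = x. The preimage is picked by choice, as [bijective] hides the inverse in
    [Prop]. *)
Lemma theta_inverse_exists : exists g : R -> R, inverse_of (@theta R) g.
Proof.
have g_ x : exists y, sym x y = x.
  by have [g _ Kg] := sym_bij x; exists (g x).
have gK x y : sym x y = x -> theta y = x.
  by move=> yE; apply: (bij_inj (sym_bij x)); rewrite -theta_sym yE.
exists (fun x => sval (cid (g_ x))); split=> x; case: cid => y /= yE.
  by apply: (bij_inj (sym_bij x)); rewrite -sym_theta yE.
exact: gK.
Qed.

Definition theta_inv : R -> R := sval (cid theta_inverse_exists).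

Lemma theta_invP : inverse_of (@theta R) theta_inv.
Proof. exact: svalP (cid theta_inverse_exists). Qed.

Lemma theta_inv_unique (g : R -> R) : cancel g (@theta R) -> theta_inv =1 g.
Proof. by move=> gK x; rewrite -{1}(gK x) (proj1 theta_invP). Qed.

Lemma theta_GL_structure : GL_structure (@theta R).
Proof.
split; last by move=> x y; exact: theta_sym.
split; first by case: theta_invP; exists theta_inv.
by move=> x y /=; rewrite theta_sym sym_theta.
Qed.

End Theta.

Lemma rack_homE (R S : rack) (f : rack_hom R S) x y :
  f (sym x y) = sym (f x) (f y).
Proof. exact: rh_funP. Qed.

Lemma rack_hom_theta (R S : rack) (f : rack_hom R S) x :
  f (theta x) = theta (f x).
Proof. exact: rack_homE. Qed.

Lemma rack_hom_theta_inv (R S : rack) (f : rack_hom R S) x :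
  f (theta_inv x) = theta_inv (f x).
Proof.
apply: (can_inj (proj1 (theta_invP S))).
by rewrite -rack_hom_theta (proj2 (theta_invP S)) (proj2 (theta_invP R)).
Qed.

Lemma medialE (R : rack) : medial R <->
  forall x x' y y' : R,
    sym (sym x' y') (sym x y) = sym (sym x' x) (sym y' y).
Proof.
by split=> [m x x' y y'|m [x x'] [y y']]; [exact: (m (x, x') (y, y'))|exact: m].
Qed.

(** * Twisting a rack by a GL-structure *)

Section Twist.

Variable L : GL_rack.

Lemma GL_map_bij : bijective (@gl_map L).
Proof. by case: (gl_mapP L) => -[]. Qed.

Lemma GL_map_sym (x y : L) : gl_map (sym x y) = sym x (gl_map y).
Proof. by case: (gl_mapP L) => _ /(_ x y). Qed.

(** Being a homomorphism and commuting with s_x give s_(u x) u = u s_x = s_x u, and u is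
    surjective. *)
Lemma sym_GL_map (x y : L) : sym (gl_map x) y = sym x y.
Proof.
have [g _ Kg] := GL_map_bij; rewrite -(Kg y) -[RHS]GL_map_sym.
by case: (gl_mapP L) => -[_ /(_ x (g y))].
Qed.

(** This single twist serves both directions: with u = theta it builds the Legendrian rack of a
    rack, and with a Legendrian u it recovers the rack. *)
Definition twist_sym (x y : L) : L := sym x (gl_map y).

Lemma twist_sym_bij x : bijective (twist_sym x).
Proof. exact: bij_comp (sym_bij x) GL_map_bij. Qed.

Lemma twist_sym_sym x y :
  twist_sym x \o twist_sym y =1 twist_sym (twist_sym x y) \o twist_sym x.
Proof.
move=> z; rewrite /twist_sym /= !GL_map_sym rack_sd.
by rewrite -(GL_map_sym x y) sym_GL_map.
Qed.

Definition twist : rack := Rack (rack_nonempty L) twist_sym_bij twist_sym_sym.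

(** Since u commutes with every s_x and s_(u x) = s_x, each side of the twisted medial law is u^2 of
    the untwisted side, and u is injective. *)
Lemma twist_medial : medial twist <-> medial L.
Proof.
have twist2 x x' y y' : twist_sym (twist_sym x' y') (twist_sym x y) =
    gl_map (gl_map (sym (sym x' y') (sym x y))).
  by rewrite /twist_sym -(GL_map_sym x' y') sym_GL_map !GL_map_sym.
rewrite !medialE; split=> m x x' y y'; last by rewrite [LHS]twist2 m -twist2.
have uI := bij_inj GL_map_bij; apply/uI/uI.
by rewrite -!twist2; exact: m.
Qed.

End Twist.

Lemma twist_hom (L M : GL_rack) (f : GL_hom L M) :
  @rack_hom_prop (twist L) (twist M) f.
Proof.
move=> x y; rewrite /= /twist_sym rack_homE.
by congr sym; exact: GL_hom_comm.
Qed.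

(** Left transparent so that composites reduce on objects and morphisms. *)
Definition twist_functor : functor legendrian_racks racks.
Proof.
apply: (@Functor legendrian_racks racks (fun A => twist (sval A))
  (fun A B f => RackHom (twist_hom f))) => *; exact: rack_hom_ext.
Defined.

(** * The Legendrian rack of a rack *)

Definition theta_twist (R : rack) : rack :=
  twist (GLRack (theta_GL_structure R)).

Lemma theta_twistE (R : rack) (x : R) :
  @theta (theta_twist R) x = theta (theta x).
Proof. exact: esym (sym_theta x (theta x)). Qed.

(** From theta, its inverse inherits commutation with s_x and the equality of the actions of x and
    its image; both survive the twist of s_x by theta. *)
Lemma theta_inv_GL_structure (R : rack) :
  @GL_structure (theta_twist R) (@theta_inv R).
Proof.
have [tK Kt] := theta_invP R.
have tI := can_inj tK.
have tC (x y : R) : theta_inv (sym x y) = sym x (theta_inv y).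
  by apply: tI; rewrite theta_sym !Kt.
have tS (x y : R) : sym (theta_inv x) y = sym x y by rewrite -sym_theta Kt.
split=> [|x y /=]; last by rewrite /twist_sym /= tC tK Kt.
split; first by exists (@theta R).
by move=> x y /=; rewrite /twist_sym /= tC tK Kt tS.
Qed.

Definition legendrian_of_rack (R : rack) : GL_rack :=
  GLRack (theta_inv_GL_structure R).

Lemma legendrian_of_rackP (R : rack) : legendrian (legendrian_of_rack R).
Proof.
have [tK Kt] := theta_invP R.
by split=> x; rewrite theta_twistE /= ?Kt // !tK.
Qed.

Lemma theta_twist_hom (R S : rack) (f : rack_hom R S) :
  @rack_hom_prop (theta_twist R) (theta_twist S) f.
Proof. by move=> x y; rewrite /= /twist_sym /= !rack_homE. Qed.

Lemma legendrian_of_rack_hom (R S : rack) (f : rack_hom R S) :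
  RackHom (theta_twist_hom f) \o @gl_map (legendrian_of_rack R) =1
  @gl_map (legendrian_of_rack S) \o RackHom (theta_twist_hom f).
Proof. exact: (rack_hom_theta_inv f). Qed.

Definition legendrian_functor : functor racks legendrian_racks.
Proof.
apply: (@Functor racks legendrian_racks
  (fun R => exist _ (legendrian_of_rack R) (legendrian_of_rackP R))
  (fun R S f => @GLHom (legendrian_of_rack R) (legendrian_of_rack S) _
     (legendrian_of_rack_hom f))) => *; exact: GL_hom_ext.
Defined.

(** * Forgetful functors and the Legendrian isomorphism *)

Definition type_cat : category :=
  @Category Type (fun A B => A -> B) (fun A => id) (fun A B C g f => g \o f)
    (fun A B f => erefl) (fun A B f => erefl) (fun A B C D h g f => erefl).

(** All constructions keep carriers and underlying maps, so over types the casts of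
    [functor_ext_over] are along [erefl]. *)
Definition rack_points : functor rack_cat type_cat :=
  @Functor rack_cat type_cat carrier (fun A B f => rh_fun f)
    (fun A => erefl) (fun A B E g f => erefl).

Lemma rack_points_faithful : faithful rack_points.
Proof.
by move=> A B f g fg; apply: rack_hom_ext => x; exact: (congr1 (@^~ x) fg).
Qed.

Definition GL_points : functor GL_cat type_cat :=
  @Functor GL_cat type_cat carrier (fun A B f => rh_fun f)
    (fun A => erefl) (fun A B E g f => erefl).

Lemma GL_points_faithful : faithful GL_points.
Proof.
by move=> A B f g fg; apply: GL_hom_ext => x; exact: (congr1 (@^~ x) fg).
Qed.

Definition symmetric_points : functor sr_cat type_cat :=
  @Functor sr_cat type_cat carrier (fun A B f => rh_fun f)
    (fun A => erefl) (fun A B E g f => erefl).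

Lemma symmetric_points_faithful : faithful symmetric_points.
Proof.
by move=> A B f g fg; apply: sr_hom_ext => x; exact: (congr1 (@^~ x) fg).
Qed.

Lemma legendrian_inverse :
  inverse_functors legendrian_functor twist_functor.
Proof.
split.
  apply: (@functor_ext_over _ _ _ rack_points
    (comp_functor twist_functor legendrian_functor) (id_functor _)
    (fun=> erefl)) => // [|R]; first exact: rack_points_faithful.
  apply: (@rack_eq R (@twist_sym (legendrian_of_rack R))) => x y.
  (* Twisting by theta and then by its inverse cancels: s_x(theta(theta^-1 y)) = s_x(y). *)
  exact: (congr1 (sym (r := R) x) (proj2 (theta_invP R) y)).
apply: (@functor_ext_over _ _ _ (comp_functor GL_points (inclusion (C := GL_cat) legendrian))
  (comp_functor legendrian_functor twist_functor) (id_functor _)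
  (fun=> erefl)) => // [A B f g fg|[L legL]].
  exact: GL_points_faithful fg.
apply: full_subcategory_eq.
(* With t the twisted operation, theta_t(u x) = s_(u x)(u(u x)) = u(u(theta x)) = x, the last step
   being the Legendrian law. *)
have uK : cancel (@gl_map L) (@theta (twist L)).
  move=> x; rewrite /theta /= /twist_sym sym_GL_map.
  by rewrite -!GL_map_sym; exact: (proj2 legL).
apply: (@GL_rack_eq L (@twist_sym (GLRack (theta_GL_structure (twist L))))
  _ _ _ (@theta_inv (twist L))) => [x y|].
  (* As u is bijective, theta_t is its two-sided inverse, so twisting by theta_t undoes the twist by
     u. *)
  exact: (congr1 (sym x) ((bij_can_sym (GL_map_bij L) _).2 uK y)).
exact: (@theta_inv_unique (twist L) _ uK).
Qed.

Lemma legendrian_functor_medial (R : rack) :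
  medial R <-> medial (theta_twist R).
Proof. by rewrite twist_medial. Qed.

Lemma theta_twist_quandle (R : rack) :
  kink_involutory R <-> quandle (theta_twist R).
Proof.
by split=> h x; [rewrite -[RHS]h -theta_twistE|rewrite -theta_twistE; exact: h].
Qed.

(** The square of the twisted symmetry at x is theta^2 s_x^2. Either side forces theta^2 to be the
    identity, after which the two squares agree. *)
Lemma theta_twist_kei (R : rack) : involutory R <-> kei (theta_twist R).
Proof.
have twist2 (x y : R) : sym (r := theta_twist R) x (sym (r := theta_twist R) x y) =
    theta (theta (sym x (sym x y))).
  by rewrite /= /twist_sym /= !theta_sym.
split=> [inv|[/theta_twist_quandle kink inv] x y]; last first.
  by rewrite -[RHS](inv x y) twist2 kink.
have kink : kink_involutory R.
  by move=> x; rewrite [LHS]/theta sym_theta; exact: inv.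
split; first exact/theta_twist_quandle.
by move=> x y; rewrite twist2 kink; exact: inv.
Qed.

(** * Involutory GL-racks and symmetric racks *)

Lemma good_involution_of_GL (L : GL_rack) :
  involutory L -> involutive (@gl_map L) -> good_involution (@gl_map L).
Proof.
move=> inv uK; split=> // x; first by move=> y; exact: GL_map_sym.
by split=> y; rewrite sym_GL_map; exact: inv.
Qed.

Lemma GL_structure_of_good_involution (S : symmetric_rack) :
  involutory S -> GL_structure (@sr_map S).
Proof.
case: (sr_mapP S) => rhoK rhoC rhoV inv; split=> //; split.
  by exists (@sr_map S).
move=> x y; rewrite rhoC /=.
(* Applying s_x leaves rho y on both sides: s_x is involutive, and s_(rho x) is its inverse. *)
apply: (bij_inj (sym_bij x)); rewrite inv.
by case: (rhoV x) => _ ->.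
Qed.

Definition symmetric_of_GL (L : involutory_GL_racks_with_involution) :
    symmetric_rack :=
  SymmetricRack (good_involution_of_GL (proj1 (svalP L)) (proj2 (svalP L))).

Definition GL_of_symmetric (S : involutory_symmetric_racks) : GL_rack :=
  GLRack (GL_structure_of_good_involution (svalP S)).

Lemma GL_of_symmetricP (S : involutory_symmetric_racks) :
  involutory (GL_of_symmetric S) /\ involutive (@gl_map (GL_of_symmetric S)).
Proof. by split; [exact: (svalP S)|case: (sr_mapP (sval S))]. Qed.

Definition symmetric_functor :
  functor involutory_GL_racks_with_involution involutory_symmetric_racks.
Proof.
apply: (@Functor involutory_GL_racks_with_involution involutory_symmetric_racks
  (fun L => exist _ (symmetric_of_GL L) (proj1 (svalP L)))
  (fun L M f => @SRHom (symmetric_of_GL L) (symmetric_of_GL M)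
     (GL_hom_fun f) (@GL_hom_comm _ _ f))) => *; exact: sr_hom_ext.
Defined.

Definition GL_functor :
  functor involutory_symmetric_racks involutory_GL_racks_with_involution.
Proof.
apply: (@Functor involutory_symmetric_racks involutory_GL_racks_with_involution
  (fun S => exist _ (GL_of_symmetric S) (GL_of_symmetricP S))
  (fun S T f => @GLHom (GL_of_symmetric S) (GL_of_symmetric T)
     (sr_hom_fun f) (@sr_hom_comm _ _ f))) => *; exact: GL_hom_ext.
Defined.

(** Each composite returns the same rack and map, and rebuilds only the proof of the structure
    law. *)
Lemma symmetric_inverse : inverse_functors symmetric_functor GL_functor.
Proof.
split.
  apply: (@functor_ext_over _ _ _ (comp_functor GL_points (inclusion (C := GL_cat) _))
    (comp_functor GL_functor symmetric_functor) (id_functor _)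
    (fun=> erefl)) => // [A B f g fg|[[L u uP] LP]].
    exact: GL_points_faithful fg.
  apply: full_subcategory_eq; congr GLRack; exact: Prop_irrelevance.
apply: (@functor_ext_over _ _ _ (comp_functor symmetric_points (inclusion (C := sr_cat) _))
  (comp_functor symmetric_functor GL_functor) (id_functor _)
  (fun=> erefl)) => // [A B f g fg|[[S rho rhoP] SP]].
  exact: symmetric_points_faithful fg.
apply: full_subcategory_eq; congr SymmetricRack; exact: Prop_irrelevance.
Qed.

(** * The isomorphisms of the theorem *)

Lemma racks_legendrian_racks : medially_isomorphic racks legendrian_racks.
Proof.
exists legendrian_functor, twist_functor; split.
  exact: legendrian_inverse.
exact: legendrian_functor_medial.
Qed.

(** Restricting [legendrian_inverse] lands in the quandles among Legendrian racks, a nested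
    subcategory that is then flattened. *)
Lemma kink_involutory_racks_legendrian_quandles :
  medially_isomorphic kink_involutory_racks legendrian_quandles.
Proof.
apply: (@medially_isomorphic_trans _
  (@full_rack_based legendrian_racks (fun L => quandle (sval L)))).
  apply: (medially_isomorphic_full legendrian_inverse).
    exact: legendrian_functor_medial.
  exact: theta_twist_quandle.
by apply: full_full_isomorphic => [L []|[L LP]] //=; tauto.
Qed.

Lemma involutory_racks_legendrian_kei :
  medially_isomorphic involutory_racks legendrian_kei.
Proof.
apply: (@medially_isomorphic_trans _
  (@full_rack_based legendrian_racks (fun L => kei (sval L)))).
  apply: (medially_isomorphic_full legendrian_inverse).
    exact: legendrian_functor_medial.
  exact: theta_twist_kei.
by apply: full_full_isomorphic => [L []|[L LP]] //=; tauto.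
Qed.

Lemma involutory_GL_racks_symmetric_racks :
  medially_isomorphic involutory_GL_racks_with_involution
    involutory_symmetric_racks.
Proof.
by exists symmetric_functor, GL_functor; split; first exact: symmetric_inverse.
Qed.

(** In a quandle theta is the identity, so the Legendrian law becomes u^2 = id. *)
Lemma legendrian_quandleE (L : GL_rack) :
  quandle L -> legendrian L <-> involutive (@gl_map L).
Proof.
move=> q; split=> [[_ uK] x|uK]; first by rewrite -[RHS]uK /theta q.
by split=> x; rewrite /theta ?q /= uK.
Qed.

(** By [legendrian_quandleE], Legendrian kei are the quandles among the involutory GL-racks with u
    an involution. As [symmetric_functor] keeps the underlying rack, it restricts to them. *)
Lemma legendrian_kei_symmetric_kei :
  medially_isomorphic legendrian_kei symmetric_kei.
Proof.
apply: (@medially_isomorphic_trans _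
  (@full_rack_based involutory_GL_racks_with_involution
     (fun L => quandle (sval L)))).
  apply: medially_isomorphic_sym; apply: full_full_isomorphic => [L|[L LP]] /=.
    by case=> leg [q inv]; split=> //; apply/(legendrian_quandleE q).
  split=> [q|[_ []]//]; case: LP => inv uK.
  by split=> //; apply/(legendrian_quandleE q).
apply: (@medially_isomorphic_trans _
  (@full_rack_based involutory_symmetric_racks (fun S => quandle (sval S)))).
  exact: (medially_isomorphic_full symmetric_inverse).
by apply: full_full_isomorphic => [S []|[S SP]] //=; rewrite /kei; tauto.
Qed.

Theorem theorem10p1 :
  (equivalent_and_isomorphic racks legendrian_racks /\
   equivalent_and_isomorphic
     (medial_objects racks)
     (medial_objects legendrian_racks)) /\
  (equivalent_and_isomorphic kink_involutory_racks legendrian_quandles /\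
   equivalent_and_isomorphic
     (medial_objects kink_involutory_racks)
     (medial_objects legendrian_quandles)) /\
  (equivalent_and_isomorphic
     involutory_GL_racks_with_involution
     involutory_symmetric_racks /\
   equivalent_and_isomorphic
     (medial_objects involutory_GL_racks_with_involution)
     (medial_objects involutory_symmetric_racks)) /\
  (equivalent_and_isomorphic involutory_racks legendrian_kei /\
   equivalent_and_isomorphic
     (medial_objects involutory_racks)
     (medial_objects legendrian_kei)) /\
  (equivalent_and_isomorphic involutory_racks symmetric_kei /\
   equivalent_and_isomorphic
     (medial_objects involutory_racks)
     (medial_objects symmetric_kei)) /\
  (equivalent_and_isomorphic legendrian_kei symmetric_kei /\
   equivalent_and_isomorphic
     (medial_objects legendrian_kei)
     (medial_objects symmetric_kei)).
Proof.
have kei_iso := involutory_racks_legendrian_kei.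
have sym_iso := legendrian_kei_symmetric_kei.
split; first exact: medially_isomorphicP racks_legendrian_racks.
split; first exact: medially_isomorphicP kink_involutory_racks_legendrian_quandles.
split; first exact: medially_isomorphicP involutory_GL_racks_symmetric_racks.
split; first exact: medially_isomorphicP kei_iso.
split; last exact: medially_isomorphicP sym_iso.
exact: medially_isomorphicP (medially_isomorphic_trans kei_iso sym_iso).
Qed.
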